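(* Let $E$ be a non-trivial locally convex Hausdorff space over $\mathbb{K}$ and let $(T^{E}_{m},T^{\mathbb{K}}_{m})_{m\in M}$ be a consistent generator for $(\mathcal{FV},E)$. Then the map $S\colon \mathcal{FV}(\Omega)\varepsilon E\to\mathcal{FV}(\Omega,E)$, $S(u)(x):=u(\delta_{x})$, is well-defined and a topological isomorphism into, i.e. it is injective, continuous, and its inverse on its range is continuous.
   Context: $\mathbb{K}\in\{\mathbb{R},\mathbb{C}\}$. Let $\Omega$ be a non-empty set, $J,M$ non-empty index sets, $(\omega_m)_{m\in M}$ non-empty sets and $\mathcal{V}=(\nu_{j,m})_{j\in J,m\in M}$ functions $\nu_{j,m}\colon\omega_m\to[0,\infty)$ such that for all $m\in M$, $x\in\omega_m$ there is $j\in J$ with $\nu_{j,m}(x)>0$. For $Y\in\{\mathbb{K},E\}$, where $E$ has a directed fundamental system of seminorms $(p_\alpha)_{\alpha\in\mathfrak{A}}$ (for $Y=\mathbb{K}$ take only $|\cdot|$), let $\operatorname{AP}(\Omega,Y)\subset Y^\Omega$ be a linear subspace and for each $m\in M$ let $T^{Y}_m\colon \operatorname{dom}T^Y_m\to Y^{\omega_m}$ be a linear map on a linear subspace $\operatorname{dom}T^Y_m\subset Y^\Omega$. Put $\mathcal{FV}(\Omega,Y):=\{f\in \operatorname{AP}(\Omega,Y)\cap\bigcap_{m}\operatorname{dom}T^Y_m : |f|_{j,m,\alpha}<\infty\ \forall j,m,\alpha\}$ with $|f|_{j,m,\alpha}:=\sup_{x\in\omega_m}p_\alpha(T^Y_m(f)(x))\nu_{j,m}(x)$,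 carrying the locally convex topology of these seminorms; $\mathcal{FV}(\Omega):=\mathcal{FV}(\Omega,\mathbb{K})$, $T^{Y}_{m,x}(f):=T^Y_m(f)(x)$. $\mathcal{FV}(\Omega,Y)$ is a dom-space if it is Hausdorff, its system of seminorms is directed, and (when $Y=\mathbb{K}$) every point evaluation $\delta_x\colon f\mapsto f(x)$, $x\in\Omega$, lies in $\mathcal{FV}(\Omega)'$. A generator for $(\mathcal{FV},E)$ is the family $(T^E_m,T^{\mathbb{K}}_m)_{m\in M}$ where $\mathcal{FV}(\Omega)$ and $\mathcal{FV}(\Omega,E)$ are both dom-spaces built with the same $J,M,\omega_m,\nu_{j,m}$. The $\varepsilon$-product $\mathcal{FV}(\Omega)\varepsilon E$ is the space of continuous linear maps $\mathcal{FV}(\Omega)'_\kappa\to E$, where $\mathcal{FV}(\Omega)'_\kappa$ is the dual with the topology of uniform convergence on absolutely convex compact subsets of $\mathcal{FV}(\Omega)$, equipped with the topology of uniform convergence on equicontinuous subsets of $\mathcal{FV}(\Omega)'$. The generator is consistent if for all $u\in\mathcal{FV}(\Omega)\varepsilon E$, $m\in M$, $x\in\omega_m$: (i) $S(u)\in\operatorname{AP}(\Omega,E)$ where $S(u)(x):=u(\delta_x)$; (ii) $S(u)\in\operatorname{dom}T^E_m$ and $T^E_m(S(u))(x)=u(T^{\mathbb{K}}_{m,x})$ (with $T^{\mathbb{K}}_{m,x}$ restricted to $\mathcal{FV}(\Omega)$). *)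

(* Defs.v *)
From HB Require Import structures.
From mathcomp Require Import all_boot all_order all_algebra.
From mathcomp Require Import all_classical all_reals ereal.
From mathcomp Require Import complex.
From Stdlib Require List.
Import Order.TTheory GRing.Theory Num.Theory.

Local Open Scope ring_scope.
Local Open Scope classical_set_scope.

Definition Kt (R : realType) (isC : bool) : numFieldType :=
  if isC then (R[i] : numFieldType) else (R : numFieldType).

Definition absK (R : realType) (isC : bool) : Kt R isC -> R :=
  match isC return Kt R isC -> R with
  | true => fun z => ComplexField.Normc.normc z
  | false => fun x => `|x|
  end.

(* Topologies generated by families of ([0,+oo]-valued) seminorms.           *)
(* [p : I -> X -> \bar R] is a family of seminorms on the group X; we work   *)
(* on the subset D of X carrying the subspace topology.                      *)

Definition sn_near {R : realType} {X : zmodType} {I : Type}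
  (p : I -> X -> \bar R) (D : set X) (x : X) (P : X -> Prop) : Prop :=
  exists (s : seq I) (d : R), 0 < d /\
    forall y, D y -> (forall i, List.In i s -> (p i (y - x)%R < d%:E)%E) -> P y.

Definition sn_open {R : realType} {X : zmodType} {I : Type}
  (p : I -> X -> \bar R) (D : set X) (U : set X) : Prop :=
  forall x, D x -> U x -> sn_near p D x U.

Definition sn_compact {R : realType} {X : zmodType} {I : Type}
  (p : I -> X -> \bar R) (D : set X) (C : set X) : Prop :=
  C `<=` D /\
  forall F : set (set X),
    (forall U, F U -> sn_open p D U) ->
    (forall x, C x -> exists U, F U /\ U x) ->
    exists us : seq (set X),
      (forall U, List.In U us -> F U) /\
      (forall x, C x -> exists U, List.In U us /\ U x).

Definition sn_cont {R : realType} {X Y : zmodType} {I I' : Type}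
  (p : I -> X -> \bar R) (D : set X) (q : I' -> Y -> \bar R) (T : X -> Y) : Prop :=
  forall x, D x -> forall (j : I') (e : R), 0 < e ->
    sn_near p D x (fun y => (q j (T y - T x)%R < e%:E)%E).

Definition sn_inv_cont {R : realType} {X Y : zmodType} {I I' : Type}
  (p : I -> X -> \bar R) (D : set X) (q : I' -> Y -> \bar R) (T : X -> Y) : Prop :=
  forall x, D x -> forall (i : I) (e : R), 0 < e ->
    exists (s : seq I') (d : R), 0 < d /\
      forall y, D y -> (forall j, List.In j s -> (q j (T y - T x)%R < d%:E)%E) ->
        (p i (y - x)%R < e%:E)%E.

Definition esup {R : realType} {T : Type} (A : set T) (g : T -> R) : \bar R :=
  ereal_sup [set (g t)%:E | t in A].

Definition lsubspace {K : numFieldType} {V : lmodType K} (S : set V) : Prop :=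
  S 0 /\ forall (a : K) f g, S f -> S g -> S (a *: f + g).

Definition lin_on {K : numFieldType} {U W : lmodType K} (D : set U) (L : U -> W) : Prop :=
  forall (a : K) f g, D f -> D g -> L (a *: f + g) = a *: L f + L g.

Definition seminorm {R : realType} {K : numFieldType} (absk : K -> R)
  {V : lmodType K} (p : V -> R) : Prop :=
  [/\ forall x, 0 <= p x,
      forall x y, p (x + y) <= p x + p y &
      forall (a : K) x, p (a *: x) = absk a * p x].

Definition directed_sn {R : realType} {V : Type} {A : Type} (p : A -> V -> R) : Prop :=
  forall a b : A, exists (c : A) (C : R), 0 <= C /\
    forall x, Num.max (p a x) (p b x) <= C * p c x.

Definition hausdorff_sn {R : realType} {V : zmodType} {A : Type} (p : A -> V -> R) : Prop :=
  forall x, (forall a, p a x = 0) -> x = 0.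

Definition absconvex {R : realType} {K : numFieldType} (absk : K -> R)
  {V : lmodType K} (C : set V) : Prop :=
  forall (a b : K) f g, C f -> C g -> absk a + absk b <= 1 -> C (a *: f + b *: g).

(* Y is a K-vector space with seminorms p : A -> Y -> R (for Y = K one takes *)
(* A = unit and p _ = |.|), T m : (Omega -> Y) -> (omega m -> Y).            *)
Definition FVsn {R : realType} {K : numFieldType} {Om : Type} {Y : lmodType K}
  {J M A : Type} (om : M -> Type) (nu : J -> forall m, om m -> R)
  (p : A -> Y -> R) (T : forall m, (Om -> Y) -> om m -> Y)
  (i : J * M * A) (f : Om -> Y) : \bar R :=
  match i with
  | (j, m, a) => esup [set: om m] (fun x : om m => p a (T m f x) * nu j m x)
  end.

Definition FVmem {R : realType} {K : numFieldType} {Om : Type} {Y : lmodType K}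
  {J M A : Type} (om : M -> Type) (nu : J -> forall m, om m -> R)
  (p : A -> Y -> R) (AP : set (Om -> Y)) (dom : M -> set (Om -> Y))
  (T : forall m, (Om -> Y) -> om m -> Y) (f : Om -> Y) : Prop :=
  [/\ AP f, forall m, dom m f &
      forall i : J * M * A, (FVsn om nu p T i f < +oo)%E].

(* X is a K-vector space with seminorms p : I -> X -> \bar R, restricted to  *)
(* the subspace D.  Elements of D' are represented by functions X -> K that  *)
(* are linear and continuous on D.                                           *)
Definition in_dual {R : realType} {K : numFieldType} (absk : K -> R)
  {X : lmodType K} {I : Type} (p : I -> X -> \bar R) (D : set X) (y : X -> K^o) : Prop :=
  lin_on D y /\ sn_cont p D (fun (_ : unit) (c : K^o) => (absk c)%:E) y.

Definition acx_compact {R : realType} {K : numFieldType} (absk : K -> R)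
  {X : lmodType K} {I : Type} (p : I -> X -> \bar R) (D : set X) (C : set X) : Prop :=
  absconvex absk C /\ sn_compact p D C.

Definition kappa_sn {R : realType} {K : numFieldType} (absk : K -> R)
  {X : lmodType K} {I : Type} (p : I -> X -> \bar R) (D : set X)
  (C : {C : set X | acx_compact absk p D C}) (y : X -> K^o) : \bar R :=
  esup (proj1_sig C) (fun f => absk (y f)).

Definition equicont {R : realType} {K : numFieldType} (absk : K -> R)
  {X : lmodType K} {I : Type} (p : I -> X -> \bar R) (D : set X) (H : set (X -> K^o)) : Prop :=
  forall x, D x -> forall e : R, 0 < e ->
    sn_near p D x (fun f => forall y, H y -> absk (y f - y x) < e).

Definition equicont_dual {R : realType} {K : numFieldType} (absk : K -> R)
  {X : lmodType K} {I : Type} (p : I -> X -> \bar R) (D : set X) (H : set (X -> K^o)) : Prop :=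
  H `<=` in_dual absk p D /\ equicont absk p D H.

Definition eps_mem {R : realType} {K : numFieldType} (absk : K -> R)
  {X : lmodType K} {I : Type} (p : I -> X -> \bar R) (D : set X)
  {V : lmodType K} {A : Type} (pE : A -> V -> R) (u : (X -> K^o) -> V) : Prop :=
  lin_on (in_dual absk p D) u /\
  sn_cont (kappa_sn absk p D) (in_dual absk p D) (fun a v => (pE a v)%:E) u.

Definition eps_sn {R : realType} {K : numFieldType} (absk : K -> R)
  {X : lmodType K} {I : Type} (p : I -> X -> \bar R) (D : set X)
  {V : lmodType K} {A : Type} (pE : A -> V -> R)
  (i : {H : set (X -> K^o) | equicont_dual absk p D H} * A) (u : (X -> K^o) -> V) : \bar R :=
  esup (proj1_sig i.1) (fun y => pE i.2 (u y)).

Definition FV_hausdorff_directed {R : realType} {K : numFieldType} {Om : Type}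
  {Y : lmodType K} {J M A : Type} (om : M -> Type) (nu : J -> forall m, om m -> R)
  (p : A -> Y -> R) (AP : set (Om -> Y)) (dom : M -> set (Om -> Y))
  (T : forall m, (Om -> Y) -> om m -> Y) : Prop :=
  (forall f, FVmem om nu p AP dom T f ->
     (forall i, FVsn om nu p T i f = 0%E) -> f = 0) /\
  (forall i1 i2 : J * M * A, exists (i3 : J * M * A) (C : R), 0 <= C /\
     forall f, FVmem om nu p AP dom T f ->
       (maxe (FVsn om nu p T i1 f) (FVsn om nu p T i2 f) <= C%:E * FVsn om nu p T i3 f)%E).

Definition Smap {K : numFieldType} {Om : Type} {V : Type}
  (u : ((Om -> K^o) -> K^o) -> V) : Om -> V :=
  fun x => u (fun f => f x).

(* Main.v *)
(* Write F for FV(Omega), and w for a difference of two elements of the epsilon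
   product.  Consistency gives T^E_m(S w)(x) = w(T^K_{m,x}), so the seminorms of S w are
   those of w on the sets {nu_{j,m}(x) T^K_{m,x} : x}, which are equicontinuous: S is
   well defined and continuous.

   Conversely, let y be in an equicontinuous set; then |y f| <= c |f|_{j,m} on F for
   some c, j, m.  Choose by Hahn-Banach a real functional g <= p_alpha on E with
   g(w y) = p_alpha(w y).  As w is kappa-continuous, Mackey-Arens represents g o w as
   z |-> Re z(f) for some f in F, and |f|_{j,m} is then at most |S w|_{j,m,alpha}.
   Hence p_alpha(w y) = Re y(f) <= c |S w|_{j,m,alpha}, which gives both injectivity and
   continuity of the inverse.  Using real parts throughout treats K = R and K = C
   uniformly. *)

Require Import Defs.
From HB Require Import structures.
From mathcomp Require Import all_boot all_order all_algebra.
From mathcomp Require Import all_classical all_reals ereal.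
From mathcomp Require Import complex.
From mathcomp Require Import ring lra.
Import Order.TTheory GRing.Theory Num.Theory.
Local Open Scope ring_scope.
Local Open Scope classical_set_scope.

(** * Real parts and real scalars *)

Definition Kre (R : realType) (isC : bool) : Kt R isC -> R :=
  match isC return Kt R isC -> R with
  | true => fun z => complex.Re z
  | false => fun x => x
  end.

Definition Kcast (R : realType) (isC : bool) : R -> Kt R isC :=
  match isC return R -> Kt R isC with
  | true => fun x => (x%:C)%C
  | false => fun x => x
  end.

Section Scalars.
Variables (R : realType) (isC : bool).
Local Notation K := (Kt R isC).
Local Notation absk := (absK R isC).
Local Notation re := (Kre R isC).
Local Notation cast := (Kcast R isC).

Lemma absK_ge0 (a : K) : 0 <= absk a.
Proof.
move: a; rewrite /absK /Kt; case: isC => a; last exact: normr_ge0.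
by case: a => x y; exact: sqrtr_ge0.
Qed.

Lemma absKM (a b : K) : absk (a * b) = absk a * absk b.
Proof.
move: a b; rewrite /absK /Kt; case: isC => a b; last exact: normrM.
exact: ComplexField.Normc.normcM.
Qed.

Lemma absKD (a b : K) : absk (a + b) <= absk a + absk b.
Proof.
move: a b; rewrite /absK /Kt; case: isC => a b; last exact: ler_normD.
exact: le_normcD.
Qed.

Lemma absK0 : absk 0 = 0.
Proof. by rewrite /absK /Kt; case: isC; [exact: ComplexField.Normc.normc0 | exact: normr0]. Qed.

Lemma absK1 : absk 1 = 1.
Proof. by rewrite /absK /Kt; case: isC; [exact: ComplexField.Normc.normc1 | exact: normr1]. Qed.

Lemma absKN (a : K) : absk (- a) = absk a.
Proof. by move: a; rewrite /absK /Kt; case: isC => a; [exact: normcN | exact: normrN]. Qed.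

Lemma absK_cast (r : R) : absk (cast r) = `|r|.
Proof.
rewrite /absK /Kt /Kcast; case: isC => //=.
by rewrite expr0n/= addr0 sqrtr_sqr.
Qed.

Lemma castD (r s : R) : cast (r + s) = cast r + cast s.
Proof. by rewrite /Kcast; case: isC => //=; rewrite raddfD. Qed.

Lemma castM (r s : R) : cast (r * s) = cast r * cast s.
Proof. by rewrite /Kcast; case: isC => //=; rewrite rmorphM. Qed.

Lemma castN (r : R) : cast (- r) = - cast r.
Proof. by rewrite /Kcast; case: isC => //=; rewrite raddfN. Qed.

Lemma cast0 : cast 0 = 0. Proof. by rewrite /Kcast; case: isC. Qed.

Lemma cast1 : cast 1 = 1. Proof. by rewrite /Kcast; case: isC. Qed.

Lemma reD (a b : K) : re (a + b) = re a + re b.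
Proof. by move: a b; rewrite /Kre /Kt; case: isC => //= -[a1 a2] [b1 b2]. Qed.

Lemma re_cast (r : R) (a : K) : re (cast r * a) = r * re a.
Proof.
move: a; rewrite /Kre /Kcast /Kt; case: isC => //= -[a1 a2] /=.
by rewrite mul0r subr0.
Qed.

Lemma re0 : re 0 = 0. Proof. by rewrite /Kre; case: isC. Qed.

Lemma reN (a : K) : re (- a) = - re a.
Proof. by apply/eqP; rewrite -subr_eq0 opprK -reD addNr re0. Qed.

Lemma re_le_abs (a : K) : re a <= absk a.
Proof.
move: a; rewrite /Kre /absK /Kt; case: isC => [[x y] /= | a]; last exact: ler_norm.
apply: (le_trans (ler_norm _)); rewrite -sqrtr_sqr ler_sqrt ?lerDl ?sqr_ge0//.
by rewrite addr_ge0 ?sqr_ge0.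
Qed.

(** For nonzero complex [a] the witness is the conjugate of [a] over its modulus, in the real case a
    sign. Such rotations turn bounds on real parts into bounds on absolute values. *)
Lemma re_phase (a : K) : exists2 c : K, absk c = 1 & re (c * a) = absk a.
Proof.
move: a; rewrite /Kre /absK /Kt; case: isC => [[x y] | a] /=; last first.
  exists (if 0 <= a then 1 else -1); first by case: ifP; rewrite ?normrN normr1.
  case: ifPn => [a0|]; first by rewrite mul1r ger0_norm.
  by rewrite -ltNge => a0; rewrite mulN1r ltr0_norm.
set n := Num.sqrt _.
have n2 : n ^+ 2 = x ^+ 2 + y ^+ 2 by rewrite sqr_sqrtr// addr_ge0 ?sqr_ge0.
have [n0|n0] := eqVneq n 0.
  exists (Complex 1 0); first by rewrite /= expr1n expr0n addr0 sqrtr1.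
  have : x ^+ 2 + y ^+ 2 = 0 by rewrite -n2 n0 expr0n.
  move/eqP; rewrite paddr_eq0 ?sqr_ge0// !sqrf_eq0 => /andP[/eqP -> /eqP ->] /=.
  by rewrite n0 !mulr0 subr0.
exists (Complex (x / n) (- y / n)) => /=; last first.
  by apply: (mulIf n0); rewrite -expr2 n2 mulrDl; field.
have -> : (x / n) ^+ 2 + (- y / n) ^+ 2 = 1.
  by rewrite !exprMn sqrrN -mulrDl -n2 exprVn mulfV// expf_neq0.
exact: sqrtr1.
Qed.

End Scalars.

(** * Hahn-Banach *)

Section HahnBanach.
Variables (R : realType) (isC : bool) (E : lmodType (Kt R isC)).
Local Notation cast := (Kcast R isC).

(** Homogeneity concerns real factors only: [E] is treated as a real vector space over either scalar
    field. *)
Definition sublinear (f : E -> R) :=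
  (forall x y, f (x + y) <= f x + f y) /\
  (forall t x, 0 <= t -> f (cast t *: x) = t * f x).

Lemma sublinear0 {f} : sublinear f -> f 0 = 0.
Proof. by move=> [_ fZ]; have := fZ 0 0 (lexx _); rewrite scaler0 mul0r. Qed.

Lemma sublinear_opp_le {f} : sublinear f -> forall x, - f (- x) <= f x.
Proof. by move=> fs x; have := fs.1 x (- x); rewrite subrr (sublinear0 fs); lra. Qed.

(* The largest sublinear minorant of f that is at most - f v at - v. *)
Definition tilt (f : E -> R) (v x : E) : R :=
  inf [set r | exists2 t : R, 0 <= t & r = f (x + cast t *: v) - t * f v].

(** Subadditivity gives [t * f v <= f (x + cast t *: v) + f (- x)], hence the lower bound
    [- f (- x)]. *)
Lemma tilt_has_inf f v x : sublinear f ->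
  has_inf [set r | exists2 t : R, 0 <= t & r = f (x + cast t *: v) - t * f v].
Proof.
move=> fs; split; first by eexists; exists 0.
exists (- f (- x)) => _ [t t0 ->].
have := fs.1 (x + cast t *: v) (- x).
by rewrite addrC addKr fs.2//; lra.
Qed.

Lemma tilt_le f v x t : sublinear f -> 0 <= t ->
  tilt f v x <= f (x + cast t *: v) - t * f v.
Proof.
by move=> fs t0; apply: ge_inf; [exact: (tilt_has_inf _ _ _ fs).2 | exists t].
Qed.

Lemma tilt_ge f v x m : sublinear f ->
  (forall t, 0 <= t -> m <= f (x + cast t *: v) - t * f v) -> m <= tilt f v x.
Proof.
move=> fs h; apply: lb_le_inf; first exact: (tilt_has_inf _ _ _ fs).1.
by move=> _ [t t0 ->]; exact: h.
Qed.

Lemma tilt_sublinear f v : sublinear f -> sublinear (tilt f v).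
Proof.
move=> fs.
(* One inequality is enough: the reverse one is [Z] at the inverse of [t] and the vector
   [cast t *: x]. *)
have Z (t : R) x : 0 < t -> tilt f v (cast t *: x) <= t * tilt f v x.
  move=> t0; rewrite mulrC -ler_pdivrMr//; apply: tilt_ge => // s s0.
  rewrite ler_pdivrMr//; apply: (le_trans (tilt_le _ _ _ (t * s) fs _)).
    by rewrite mulr_ge0// (ltW t0).
  rewrite castM -scalerA -scalerDr fs.2 ?(ltW t0)//.
  by rewrite le_eqVlt; apply/orP; left; apply/eqP; ring.
split=> [x y|t x].
  rewrite -lerBlDr; apply: tilt_ge => // s s0.
  rewrite lerBlDr -lerBlDl; apply: tilt_ge => // t t0.
  rewrite lerBlDl; apply: (le_trans (tilt_le _ _ _ (s + t) fs _)).
    by rewrite addr_ge0.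
  rewrite castD scalerDl addrACA.
  by have := fs.1 (x + cast s *: v) (y + cast t *: v); lra.
rewrite le_eqVlt => /orP[/eqP <-|t0].
  rewrite cast0 scale0r mul0r; apply/eqP; rewrite eq_le; apply/andP; split.
    apply: (le_trans (tilt_le _ _ _ 0 fs _)) => //.
    by rewrite cast0 scale0r addr0 (sublinear0 fs) mul0r subr0.
  by apply: tilt_ge => // s s0; rewrite add0r fs.2// subrr.
apply/eqP; rewrite eq_le Z//=.
have := Z t^-1 (cast t *: x); rewrite invr_gt0 => /(_ t0).
by rewrite scalerA -castM mulVf ?gt_eqF// cast1 scale1r mulrC ler_pdivlMr// mulrC.
Qed.

Lemma tilt_le_self f v x : sublinear f -> tilt f v x <= f x.
Proof.
move=> fs; have := tilt_le f v x 0 fs (lexx _).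
by rewrite cast0 scale0r addr0 mul0r subr0.
Qed.

Lemma tilt_opp f v : sublinear f -> tilt f v (- v) <= - f v.
Proof.
move=> fs; have := tilt_le f v (- v) 1 fs ler01.
by rewrite cast1 scale1r addNr (sublinear0 fs) mul1r sub0r.
Qed.

(** Zorn's lemma: a non-empty chain is bounded by its pointwise infimum, finite because every member
    satisfies [- f (- x) <= g x]. *)
Lemma minimal_sublinear f : sublinear f ->
  exists g, [/\ sublinear g, forall x, g x <= f x &
    forall h, sublinear h -> (forall x, h x <= g x) -> h = g].
Proof.
move=> fs.
pose T := {g : E -> R | sublinear g /\ forall x, g x <= f x}.
(* The order is reversed, so that maximal elements are minimal functionals. *)
pose le (g h : T) := `[< forall x, sval h x <= sval g x >].
have [|||A Atot|[g [gs gf]] gmin] := @Zorn T le.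
- by move=> g; apply/asboolP.
- by move=> g h k /asboolP gh /asboolP hk; apply/asboolP => x; exact: le_trans (gh x).
- move=> [g gP] [h hP] /asboolP gh /asboolP hg; apply: eq_exist; apply/funext => x.
  by apply/eqP; rewrite eq_le (gh x) (hg x).
- have [[g0 Ag0]|A0] := pselect (exists g, A g); last first.
    by exists (exist _ f (conj fs (fun=> lexx _))) => g Ag; case: A0; exists g.
  pose S x := [set r | exists2 g : T, A g & r = sval g x].
  have Sinf x : has_inf (S x).
    split; first by exists (sval g0 x), g0.
    exists (- f (- x)) => _ [[g [gs gf]] _ ->] /=.
    by rewrite (le_trans _ (sublinear_opp_le gs x))// lerN2.
  pose k x := inf (S x).
  have k_le g x : A g -> k x <= sval g x.
    by move=> Ag; apply: ge_inf; [exact: (Sinf x).2 | exists g].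
  have k_ge m x : (forall g, A g -> m <= sval g x) -> m <= k x.
    by move=> h; apply: lb_le_inf; [exact: (Sinf x).1 | move=> _ [g Ag ->]; exact: h].
  have ks : sublinear k.
    split=> [x y|t x].
      rewrite -lerBlDr; apply: (k_ge) => g Ag.
      rewrite lerBlDr -lerBlDl; apply: k_ge => h Ah; rewrite lerBlDl.
      (* The smaller of the two chain members serves for both [x] and [y]. *)
      have [/asboolP gh|/asboolP hg] := Atot _ _ Ag Ah.
        apply: (le_trans (k_le _ _ Ah)); have := (svalP h).1.1 x y; have := gh x; lra.
      apply: (le_trans (k_le _ _ Ag)); have := (svalP g).1.1 x y; have := hg y; lra.
    rewrite le_eqVlt => /orP[/eqP <-|t0].
      rewrite cast0 scale0r mul0r; apply/eqP; rewrite eq_le; apply/andP; split.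
        by rewrite (le_trans (k_le _ _ Ag0))// (sublinear0 (svalP g0).1).
      by apply: k_ge => g Ag; rewrite (sublinear0 (svalP g).1).
    apply/eqP; rewrite eq_le; apply/andP; split.
      rewrite mulrC -ler_pdivrMr//; apply: k_ge => g Ag; rewrite ler_pdivrMr// mulrC.
      by rewrite -(svalP g).1.2 ?(ltW t0)// k_le.
    apply: k_ge => g Ag; rewrite (svalP g).1.2 ?(ltW t0)// ler_wpM2l ?(ltW t0)//.
    exact: k_le.
  have kf x : k x <= f x by exact: le_trans (k_le _ _ Ag0) ((svalP g0).2 x).
  by exists (exist _ k (conj ks kf)) => g Ag; apply/asboolP => x /=; exact: k_le.
exists g; split=> // h hs hg.
have hf x : h x <= f x by exact: le_trans (hg x) (gf x).
by have := gmin (exist _ h (conj hs hf)) (asboolT hg) => -[].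
Qed.

(* A minimal sublinear functional is odd because it coincides with its tilts. *)
Lemma hahn_banach (f : E -> R) (v : E) : sublinear f ->
  exists g : E -> R, [/\ forall x y, g (x + y) = g x + g y,
    forall t x, g (cast t *: x) = t * g x, forall x, g x <= f x & g v = f v].
Proof.
move=> fs; have [g [gs gf gmin]] := minimal_sublinear _ (tilt_sublinear f v fs).
have gN x : g (- x) = - g x.
  apply/eqP; rewrite eq_le; apply/andP; split; last first.
    by rewrite lerNl sublinear_opp_le.
  have tg : tilt g x = g.
    by apply: gmin => [|z]; [exact: tilt_sublinear | exact: tilt_le_self].
  by have := tilt_opp g x gs; rewrite tg.
have gle x : g x <= f x by exact: le_trans (gf x) (tilt_le_self _ _ _ fs).
exists g; split=> //.
- move=> x y; apply/eqP; rewrite eq_le gs.1/=.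
  by have := gs.1 (x + y) (- y); rewrite addrK gN; lra.
- move=> t x; have [t0|t0] := leP 0 t; first exact: gs.2.
  have := gs.2 (- t) x; rewrite oppr_ge0 => /(_ (ltW t0)).
  by rewrite castN scaleNr gN mulNr => /oppr_inj.
(* The tilt along [v] forces [g (- v) <= - f v], that is [f v <= g v]. *)
- apply/eqP; rewrite eq_le gle/= -lerN2 -gN.
  exact: le_trans (gf _) (tilt_opp _ _ fs).
Qed.

End HahnBanach.

(** * Compactness *)

(* q is the real-valued version, on the subspace D, of the extended seminorms p. *)
Definition seminorms_on {R : realType} {K : numFieldType} (absk : K -> R)
  {X : lmodType K} {I : Type} (p : I -> X -> \bar R) (D : set X) (q : I -> X -> R) :=
  [/\ forall i f, D f -> p i f = (q i f)%:E,
      forall i f, D f -> 0 <= q i f,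
      forall i f g, D f -> D g -> q i (f + g) <= q i f + q i g &
      forall i a f, D f -> q i (a *: f) <= absk a * q i f].

Section Topology.
Variables (R : realType) (isC : bool).
Local Notation K := (Kt R isC).
Local Notation absk := (absK R isC).
Local Notation re := (Kre R isC).
Local Notation cast := (Kcast R isC).
Variables (X : lmodType K) (I : Type) (p : I -> X -> \bar R) (D : set X).
Variable q : I -> X -> R.
Hypothesis D_sub : lsubspace D.
Hypothesis pq : seminorms_on absk p D q.
Local Notation near := (sn_near p D).
Local Notation dual := (in_dual absk p D).

(** * Neighbourhood calculus for seminorms on a linear subspace *)

Lemma subspace0 : D 0. Proof. exact: D_sub.1. Qed.

Lemma subspaceZ a f : D f -> D (a *: f).
Proof. by move=> Df; have := D_sub.2 a f 0 Df subspace0; rewrite addr0. Qed.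

Lemma subspaceD f g : D f -> D g -> D (f + g).
Proof. by move=> Df Dg; have := D_sub.2 1 f g Df Dg; rewrite scale1r. Qed.

Lemma subspaceB f g : D f -> D g -> D (f - g).
Proof. by move=> Df Dg; rewrite -scaleN1r; apply: subspaceD => //; exact: subspaceZ. Qed.

Lemma snE i f : D f -> p i f = (q i f)%:E. Proof. by case: pq => + _ _ _; apply. Qed.
Lemma sn_ge0 i f : D f -> 0 <= q i f. Proof. by case: pq => _ + _ _; apply. Qed.
Lemma snD i f g : D f -> D g -> q i (f + g) <= q i f + q i g.
Proof. by case: pq => _ _ + _; apply. Qed.
Lemma snZ i a f : D f -> q i (a *: f) <= absk a * q i f.
Proof. by case: pq => _ _ _; apply. Qed.

Lemma sn0 i : q i 0 = 0.
Proof.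
apply/eqP; rewrite eq_le sn_ge0 ?andbT; last exact: subspace0.
by have := snZ i 0 0 subspace0; rewrite scale0r absK0 mul0r.
Qed.

Lemma sn_near_intro (s : seq I) (d : R) x (P : X -> Prop) : D x -> 0 < d ->
  (forall y, D y -> (forall i, List.In i s -> q i (y - x) < d) -> P y) -> near x P.
Proof.
move=> Dx d0 h; exists s, d; split=> // y Dy hy; apply: h => // i si.
by have := hy _ si; rewrite snE ?lte_fin//; exact: subspaceB.
Qed.

Lemma sn_near_elim x (P : X -> Prop) : D x -> near x P ->
  exists (s : seq I) (d : R), 0 < d /\
    forall y, D y -> (forall i, List.In i s -> q i (y - x) < d) -> P y.
Proof.
move=> Dx [s [d [d0 h]]]; exists s, d; split=> // y Dy hy; apply: h => // i si.
by rewrite snE ?lte_fin ?hy//; exact: subspaceB.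
Qed.

Lemma sn_near_imp x (P Q : X -> Prop) :
  (forall y, D y -> P y -> Q y) -> near x P -> near x Q.
Proof. by move=> PQ [s [d [d0 h]]]; exists s, d; split=> // y Dy /(h _ Dy)/PQ; apply. Qed.

Lemma sn_near_and x (P Q : X -> Prop) :
  near x P -> near x Q -> near x (fun y => P y /\ Q y).
Proof.
move=> [s [d [d0 h]]] [s' [d' [d'0 h']]]; exists (s ++ s'), (Num.min d d').
split; first by rewrite lt_min d0.
move=> y Dy hy; split.
- apply: h => // i si; apply: (lt_le_trans (hy i _)); last by rewrite lee_fin ge_min lexx.
  by apply: List.in_or_app; left.
- apply: h' => // i si; apply: (lt_le_trans (hy i _)); last by rewrite lee_fin ge_min lexx orbT.
  by apply: List.in_or_app; right.
Qed.

Lemma sn_near_self x (P : X -> Prop) : D x -> near x P -> P x.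
Proof.
by move=> Dx /(sn_near_elim _ _ Dx)[s [d [d0 h]]]; apply: h => // i _; rewrite subrr sn0.
Qed.

(** Compactness speaks of open covers, while local properties come with neighbourhoods; halving the
    radius passes from the latter to the former. *)
Lemma sn_open_interior (N : set X) : sn_open p D [set z | D z /\ near z N].
Proof.
move=> x Dx [_ /(sn_near_elim _ _ Dx)[s [d [d0 h]]]].
have d20 : 0 < d / 2 by rewrite divr_gt0.
apply: (sn_near_intro s (d / 2)) => // z Dz hz; split=> //.
apply: (sn_near_intro s (d / 2)) => // y Dy hy; apply: h => // i si.
have -> : y - x = (y - z) + (z - x) by rewrite addrA subrK.
apply: (le_lt_trans (snD _ _ _ _ _)); [exact: subspaceB | exact: subspaceB |].
by rewrite (splitr d) ltrD ?hy ?hz.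
Qed.

(** Compactness as an induction principle: the open sets satisfying [Q] cover [C], and [Q] passes to
    finite unions and subsets. *)
Lemma compact_ind (C : set X) (Q : set X -> Prop) : sn_compact p D C ->
  Q set0 -> (forall A B, Q A -> Q B -> Q (A `|` B)) ->
  (forall A B, A `<=` B -> Q B -> Q A) ->
  (forall x, C x -> exists2 N, near x N & Q N) -> Q C.
Proof.
move=> [CD cov] Q0 QU Qsub Qloc.
have [U [oU QUs]|x Cx|us [usF usC]] := cov [set U | sn_open p D U /\ Q U].
- exact: oU.
- have [N nN QN] := Qloc _ Cx; exists [set z | D z /\ near z N]; split.
    split; first exact: sn_open_interior.
    by apply: Qsub QN => z [Dz /(sn_near_self _ _ Dz)].
  by split=> //; exact: CD.
have : Q [set x | exists U, List.In U us /\ U x].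
  elim: us usF {usC} => [_|U us IH usF].
    by apply: Qsub Q0 => x [U [[]]].
  apply: (@Qsub _ (U `|` [set x | exists U, List.In U us /\ U x])).
    by move=> x [V [/= [<-|Vus] Vx]]; [left | right; exists V].
  apply: QU; first by have [] := usF U (or_introl erefl).
  by apply: IH => V Vus; apply: usF; right.
by apply: Qsub => x /usC.
Qed.

(** Lower semicontinuity suffices. If the infimum were not attained, [h] would locally stay above a
    number exceeding it, and by compactness one such number would serve on all of [C]. *)
Lemma compact_min (C : set X) (h : X -> R) : sn_compact p D C -> C !=set0 ->
  (forall x, 0 <= h x) ->
  (forall x e, C x -> 0 < e -> near x (fun y => h x - e < h y)) ->
  exists2 x, C x & forall y, C y -> h x <= h y.
Proof.
move=> Cc [x0 Cx0] h0 hlsc; apply: contrapT => nomin.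
have Cinf : has_inf [set h x | x in C].
  by split; [exists (h x0), x0 | exists 0 => _ [x _ <-]].
set m := inf [set h x | x in C].
have mle x : C x -> m <= h x by move=> Cx; apply: ge_inf; [exact: Cinf.2 | exists x].
have [|A B [a am ha] [b bm hb]|A B AB [b bm hb]|x Cx|m' mm' hm'] :=
    compact_ind C (fun N => exists2 m', m < m' & forall x, N x -> C x -> m' <= h x) Cc.
- by exists (m + 1); rewrite ?ltrDl.
- exists (Num.min a b); first by rewrite lt_min am.
  by move=> x [Ax|Bx] Cx; rewrite ge_min; [rewrite ha | rewrite hb ?orbT].
- by exists b => // x /AB; exact: hb.
- have mx : m < h x.
    rewrite lt_neqAle mle// andbT; apply/eqP => mx; apply: nomin; exists x => // y Cy.
    by rewrite -mx mle.
  exists [set y | h x - (h x - m) / 2 < h y].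
    by apply: hlsc => //; rewrite divr_gt0// subr_gt0.
  by exists (h x - (h x - m) / 2) => [|y /= /ltW//]; lra.
have : m' <= m by apply: lb_le_inf; [exact: Cinf.1 | move=> _ [x Cx <-]; exact: hm'].
by rewrite leNgt mm'.
Qed.

Lemma compact_sn_bounded (C : set X) i : sn_compact p D C ->
  exists2 r : R, 0 <= r & forall f, C f -> q i f <= r.
Proof.
move=> Cc; have CD := Cc.1.
have [|A B [a a0 ha] [b b0 hb]|A B AB [b b0 hb]|x Cx|r r0 hr] :=
    compact_ind C (fun N => exists2 r, 0 <= r & forall f, N f -> C f -> q i f <= r) Cc.
- by exists 0.
- exists (Num.max a b); first by rewrite le_max a0.
  by move=> x [Ax|Bx] Cx; rewrite le_max; [rewrite ha | rewrite hb ?orbT].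
- by exists b => // x /AB; exact: hb.
- exists [set y | D y /\ q i (y - x) < 1].
    apply: (sn_near_intro [:: i] 1) => //; first exact: CD.
    by move=> y Dy hy; split=> //; apply: hy; left.
  exists (1 + q i x); first by rewrite addr_ge0// sn_ge0//; exact: CD.
  move=> y [Dy yx] _; rewrite -[y](subrK x); apply: (le_trans (snD _ _ _ _ _)).
  + by apply: subspaceB => //; exact: CD.
  + exact: CD.
  + by rewrite lerD2r ltW.
by exists r => // f Cf; exact: hr.
Qed.

(** * Sums of absolutely convex compact sets *)

Definition set_sum (A B : set X) : set X := [set f | exists a b, [/\ A a, B b & f = a + b]].

(** A tube argument: two nested compactness inductions, over [A] and, at each of its points, over
    [B]. *)
Lemma sn_compact_sum (A B : set X) : sn_compact p D A -> sn_compact p D B ->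
  sn_compact p D (set_sum A B).
Proof.
move=> Ac Bc; have AD := Ac.1; have BD := Bc.1.
split=> [_ [a [b [Aa Bb ->]]]|F Fo Fcov].
  by apply: subspaceD; [exact: AD | exact: BD].
have [||||us [usF usC]] := compact_ind A (fun W => exists us : seq (set X),
    (forall U, List.In U us -> F U) /\
    forall a b, D a -> W a -> B b -> exists U, List.In U us /\ U (a + b)) Ac.
- by exists [::].
- move=> W W' [us [usF h]] [us' [us'F h']]; exists (us ++ us'); split.
    by move=> U /(@List.in_app_or _ _ _ _) [/usF|/us'F].
  move=> a b Da [Wa|Wa] Bb.
    by have [U [? ?]] := h a b Da Wa Bb; exists U; split=> //; apply: List.in_or_app; left.
  by have [U [? ?]] := h' a b Da Wa Bb; exists U; split=> //; apply: List.in_or_app; right.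
- move=> W W' WW' [us [usF h]]; exists us; split=> // a b Da /WW'; exact: h.
- move=> a Aa; have Da := AD _ Aa.
  (* With [a] fixed, finitely many sets of the cover contain [N + B] for one neighbourhood [N] of
     [a] in [D]. *)
  have [||||N [us [nN usF usC]]] := compact_ind B (fun V => exists N (us : seq (set X)),
    [/\ near a N, (forall U, List.In U us -> F U) &
      forall a' b, D a' -> D b -> N a' -> V b -> exists U, List.In U us /\ U (a' + b)]) Bc.
  + by exists setT, [::]; split=> //; apply: (sn_near_intro [::] 1).
  + move=> V V' [N [us [nN usF h]]] [N' [us' [nN' us'F h']]].
    exists (N `&` N'), (us ++ us'); split; first exact: sn_near_and.
      by move=> U /(@List.in_app_or _ _ _ _) [/usF|/us'F].
    move=> a' b Da' Db [Na N'a] [Vb|Vb].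
      have [U [? ?]] := h a' b Da' Db Na Vb.
      by exists U; split=> //; apply: List.in_or_app; left.
    have [U [? ?]] := h' a' b Da' Db N'a Vb.
    by exists U; split=> //; apply: List.in_or_app; right.
  + move=> V V' VV' [N [us [nN usF h]]]; exists N, us; split=> // a' b Da' Db Na /VV'.
    exact: h.
  + move=> b Bb; have Db := BD _ Bb.
    have [U [FU Uab]] := Fcov (a + b) (ex_intro _ a (ex_intro _ b (And3 Aa Bb erefl))).
    have Dab := subspaceD _ _ Da Db.
    have [s [d [d0 h]]] := sn_near_elim _ _ Dab (Fo _ FU _ Dab Uab).
    have d20 : 0 < d / 2 by rewrite divr_gt0.
    exists [set y | forall i, List.In i s -> q i (y - b) < d / 2].
      exact: (sn_near_intro s (d / 2)).
    exists [set y | forall i, List.In i s -> q i (y - a) < d / 2], [:: U]; split.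
    * exact: (sn_near_intro s (d / 2)).
    * by move=> _ /= [<-|[]].
    * move=> a' b' Da' Db' ha hb; exists U; split; first by left.
      apply: h; first exact: subspaceD.
      move=> i si; rewrite opprD addrACA.
      apply: (le_lt_trans (snD _ _ _ _ _)); [exact: subspaceB | exact: subspaceB |].
      by rewrite (splitr d) ltrD ?ha ?hb.
  exists N => //; exists us; split=> // a' b Da' Na Bb.
  by have [] := usC a' b Da' (BD _ Bb) Na Bb => U; exists U.
exists us; split=> // _ [a [b [Aa Bb ->]]].
by apply: usC => //; exact: AD.
Qed.

Lemma absconvex_sum (A B : set X) : absconvex absk A -> absconvex absk B ->
  absconvex absk (set_sum A B).
Proof.
move=> Ac Bc a b _ _ [f [g [Af Bg ->]]] [f' [g' [Af' Bg' ->]]] ab.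
exists (a *: f + b *: f'), (a *: g + b *: g'); split; [exact: Ac | exact: Bc |].
by rewrite !scalerDr addrACA.
Qed.

Lemma absconvex0 (A : set X) : absconvex absk A -> A !=set0 -> A 0.
Proof.
move=> Ac [f Af]; have := Ac 0 0 f f Af Af.
by rewrite !scale0r addr0 absK0 addr0; apply.
Qed.

Lemma acx_compact0 : acx_compact absk p D [set 0].
Proof.
split=> [a b _ _ -> -> _ /=|]; first by rewrite !scaler0 addr0.
split=> [_ ->|F Fo Fcov]; first exact: subspace0.
have [U [FU U0]] := Fcov 0 erefl; exists [:: U]; split=> [_ /= [<-|[]]//|_ ->].
by exists U; split=> //; left.
Qed.

(** The sum of the non-empty sets in the list contains each of them, since each contains 0. It
    reduces a basic kappa-neighbourhood to one compact set. *)
Lemma acx_compact_hull (s : seq {C : set X | acx_compact absk p D C}) :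
  exists C, [/\ acx_compact absk p D C, C !=set0 &
    forall B, List.In B s -> proj1_sig B `<=` C].
Proof.
elim: s => [|B s [C [Cc C0 sC]]].
  by exists [set 0]; split=> //; [exact: acx_compact0 | exists 0].
(* An empty set counts as absolutely convex here and would make the sum empty, so it is skipped. *)
have [[f Bf]|B0] := pselect (proj1_sig B !=set0); last first.
  exists C; split=> // B' /= [<-|/sC//] x Bx.
  by exfalso; apply: B0; exists x.
have [Bx Bc] := proj2_sig B; case: Cc => Cx Cc.
have B0 : proj1_sig B 0 by apply: absconvex0 => //; exists f.
have C00 : C 0 by exact: absconvex0.
exists (set_sum (proj1_sig B) C); split.
- by split; [exact: absconvex_sum | exact: sn_compact_sum].
- by exists 0; exists 0, 0; rewrite addr0.
move=> B' /= [<- x B'x|/sC B'C x /B'C Cx'].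
  by exists x, 0; rewrite addr0.
by exists 0, x; rewrite add0r.
Qed.


(** * The dual space *)

Lemma dual_near (y : X -> K^o) x (e : R) : dual y -> D x -> 0 < e ->
  near x (fun f => absk (y f - y x) < e).
Proof.
by move=> [_ yc] Dx e0; apply: sn_near_imp (yc x Dx tt e e0) => f _; rewrite lte_fin.
Qed.

Lemma dualP (y : X -> K^o) : lin_on D y ->
  (forall x (e : R), D x -> 0 < e -> near x (fun f => absk (y f - y x) < e)) -> dual y.
Proof.
move=> yl yc; split=> // x Dx _ e e0.
by apply: sn_near_imp (yc x e Dx e0) => f _; rewrite lte_fin.
Qed.

Lemma dual0 : dual 0.
Proof.
apply: dualP => [a f g _ _|x e Dx e0]; first by rewrite scaler0 addr0.
by apply: (sn_near_intro [::] 1) => // f _ _; rewrite subrr absK0.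
Qed.

Lemma dualDZ a (y z : X -> K^o) : dual y -> dual z -> dual (a *: y + z).
Proof.
move=> yd zd; apply: dualP => [b f g Df Dg|x e Dx e0].
  have -> : forall h, (a *: y + z) h = a * y h + z h by [].
  rewrite yd.1// zd.1// mulrDr scalerDr addrACA; congr (_ + _ + _).
  exact: mulrCA.
have e1 : 0 < e / 2 / (absk a + 1).
  by rewrite divr_gt0 ?divr_gt0// ltr_wpDl// absK_ge0.
have e2 : 0 < e / 2 by rewrite divr_gt0.
apply: sn_near_imp (sn_near_and _ _ _ (dual_near _ _ _ yd Dx e1) (dual_near _ _ _ zd Dx e2)).
move=> f Df [h1 h2].
have -> : (a *: y + z) f - (a *: y + z) x = a * (y f - y x) + (z f - z x).
  have -> : forall h, (a *: y + z) h = a * y h + z h by [].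
  by rewrite mulrBr opprD addrACA.
apply: (le_lt_trans (absKD _ _ _ _)); rewrite absKM [ltRHS](splitr e) ler_ltD//.
move: h1; rewrite ltr_pdivlMr ?ltr_wpDl ?absK_ge0// => /ltW; apply: le_trans.
by rewrite mulrC ler_wpM2l ?absK_ge0// lerDl.
Qed.

Lemma dualZ a (y : X -> K^o) : dual y -> dual (a *: y).
Proof. by move=> yd; rewrite -[_ *: _]addr0; apply: dualDZ => //; exact: dual0. Qed.

Lemma dual_at0 (y : X -> K^o) : dual y -> y 0 = 0.
Proof.
move=> yd; have := yd.1 (-1) 0 0 subspace0 subspace0.
by rewrite scaler0 addr0 scaleN1r addNr.
Qed.

Lemma dual_lin (y : X -> K^o) a b f g : dual y -> D f -> D g ->
  y (a *: f + b *: g) = a * y f + b * y g.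
Proof.
move=> yd Df Dg; rewrite yd.1//; last exact: subspaceZ.
by have := yd.1 b g 0 Dg subspace0; rewrite dual_at0// !addr0 => ->.
Qed.

Lemma dual_scale (y : X -> K^o) a f : dual y -> D f -> y (a *: f) = a * y f.
Proof.
move=> yd Df; have := dual_lin y a 0 f 0 yd Df subspace0.
by rewrite scale0r addr0 mul0r addr0.
Qed.

(** * Representation of real-linear functionals on the dual by points of a compact set *)

Lemma dual_comb (ys : seq (X -> K^o)) (c : (X -> K^o) -> R)
    (psi : (X -> K^o) -> R) :
  (forall y, y \in ys -> dual y) ->
  (forall y z, dual y -> dual z -> psi (y + z) = psi y + psi z) ->
  (forall t y, dual y -> psi (cast t *: y) = t * psi y) ->
  let v := \sum_(y <- ys) cast (c y) *: y in
  [/\ dual v, psi v = \sum_(y <- ys) c y * psi y &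
      forall f, re (v f) = \sum_(y <- ys) c y * re (y f)].
Proof.
move=> ysd psiD psiZ /=; elim: ys ysd => [|y ys IH] ysd.
  rewrite !big_nil; split; first exact: dual0.
    by have := psiZ 0 _ dual0; rewrite scaler0 mul0r.
  by move=> f; rewrite big_nil re0.
have yd : dual y by apply: ysd; rewrite mem_head.
have [|vd psiv rev] := IH; first by move=> z zs; apply: ysd; rewrite in_cons zs orbT.
rewrite !big_cons; split.
- exact: dualDZ.
- by rewrite psiD ?psiZ// ?psiv//; exact: dualZ.
- by move=> f; rewrite big_cons -rev -re_cast -reD.
Qed.

(* Otherwise finitely many dual vectors already separate psi from C, and the
   residual at the least-squares approximation of psi on these vectors by points
   of C is a dual vector violating the bound. *)
Theorem mackey_arens (C : set X) (psi : (X -> K^o) -> R) :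
  acx_compact absk p D C ->
  (forall y z, dual y -> dual z -> psi (y + z) = psi y + psi z) ->
  (forall t y, dual y -> psi (cast t *: y) = t * psi y) ->
  (forall y (r : R), dual y -> (forall f, C f -> re (y f) <= r) -> psi y <= r) ->
  exists2 f, C f & forall y, dual y -> psi y = re (y f).
Proof.
move=> [Cx Cc] psiD psiZ psile; have CD := Cc.1.
have psi0 : psi 0 = 0 by have := psiZ 0 _ dual0; rewrite scaler0 mul0r.
(* Over an empty [C] the domination hypothesis would bound [psi 0] even by [-1]. *)
have Cn0 : C !=set0.
  apply: contrapT => C0; have : psi 0 <= -1; last by rewrite psi0; lra.
  by apply: psile => [|f Cf]; [exact: dual0 | case: C0; exists f].
apply: contrapT => nof.
(* Each point of [C] disagrees with [psi] at some dual vector, and so do nearby points; compactness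
   leaves a finite list. *)
have [||||ys [ysd ysC]] := compact_ind C (fun N => exists ys : seq (X -> K^o),
    (forall y, y \in ys -> dual y) /\
    forall f, C f -> N f -> exists2 y, y \in ys & psi y != re (y f)) Cc.
- by exists [::].
- move=> A B [ys [ysd hA]] [zs [zsd hB]]; exists (ys ++ zs); split.
    by move=> y; rewrite mem_cat => /orP[/ysd|/zsd].
  move=> f Cf [Af|Bf].
    by have [y ? ?] := hA f Cf Af; exists y => //; rewrite mem_cat; apply/orP; left.
  by have [y ? ?] := hB f Cf Bf; exists y => //; rewrite mem_cat; apply/orP; right.
- by move=> A B AB [ys [ysd hB]]; exists ys; split=> // f Cf /AB; exact: hB.
- move=> x Cx'; have Dx := CD _ Cx'.
  have [y yd yx] : exists2 y, dual y & psi y != re (y x).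
    apply: contrapT => noy; apply: nof; exists x => // y yd.
    by apply: contrapT => yx; apply: noy; exists y => //; exact/eqP.
  exists [set f | absk (y f - y x) < `|psi y - re (y x)|].
    by apply: dual_near; rewrite ?normr_gt0 ?subr_eq0.
  exists [:: y]; split=> [z|f Cf /= fy]; first by rewrite inE => /eqP ->.
  exists y; rewrite ?mem_head//; apply/eqP => psiy.
  move: fy; rewrite psiy -reN -reD; apply/negP; rewrite -leNgt ler_norml re_le_abs andbT.
  by rewrite lerNl -reN (le_trans (re_le_abs _ _ _))// absKN.
(* [b f] is the residual on [ys], [h f] its squared length, and [v f] the dual vector with the
   residual as coefficients; [hE] expands the square around [f]. *)
pose b f y := psi y - re (y f).
pose v f := \sum_(y <- ys) cast (b f y) *: y.
pose h f := \sum_(y <- ys) (b f y) ^+ 2.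
have vd f : dual (v f) by have [] := dual_comb ys (b f) psi ysd psiD psiZ.
have vE f g : re (v f g) = \sum_(y <- ys) b f y * re (y g).
  by have [_ _] := dual_comb ys (b f) psi ysd psiD psiZ; apply.
have psiv f : psi (v f) = \sum_(y <- ys) b f y * psi y.
  by have [] := dual_comb ys (b f) psi ysd psiD psiZ.
have hE f g : h g = h f - 2 * (re (v f g) - re (v f f)) +
    \sum_(y <- ys) (re (y g) - re (y f)) ^+ 2.
  rewrite !vE /h -sumrB mulr_sumr -sumrB -big_split /=.
  by apply: eq_bigr => y _; rewrite /b; ring.
have hpsi f : psi (v f) = re (v f f) + h f.
  rewrite psiv vE /h -big_split /=; apply: eq_bigr => y _; rewrite /b; ring.
have h_ge0 f : 0 <= h f by apply: sumr_ge0 => y _; exact: sqr_ge0.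
have h_gt0 f : C f -> 0 < h f.
  move=> Cf; rewrite lt_neqAle h_ge0 andbT eq_sym psumr_eq0; last by move=> y _; exact: sqr_ge0.
  apply/negP => /allP h0; have [y yys] := ysC f Cf Cf.
  by rewrite -subr_eq0 -sqrf_eq0 => /negP; apply; exact: h0.
(* Lower semicontinuity of [h]: in [hE] the linear term is continuous and the quadratic one
   nonnegative. *)
have [x e Cx' e0|f Cf fmin] := compact_min C h Cc Cn0 h_ge0.
  have Dx := CD _ Cx'; have e2 : 0 < e / 2 by rewrite divr_gt0.
  apply: sn_near_imp (dual_near _ _ _ (vd x) Dx e2) => g Dg hg.
  rewrite (hE x g) -addrA ltrD2l.
  have : 0 <= \sum_(y <- ys) (re (y g) - re (y x)) ^+ 2.
    by apply: sumr_ge0 => y _; exact: sqr_ge0.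
  have := le_lt_trans (re_le_abs _ _ _) hg; rewrite reD reN.
  set A := re _; set B := re _; set S := \sum_(_ <- _) _; lra.
have Df := CD _ Cf.
(* First-order condition at the minimiser: a violating [g] would let [h] decrease along the segment
   from [f] to [g]. *)
have vmax g : C g -> re (v f g) <= re (v f f).
  move=> Cg; have Dg := CD _ Cg; rewrite leNgt; apply/negP => lt_fg.
  pose a := re (v f g) - re (v f f).
  pose S := \sum_(y <- ys) (re (y g) - re (y f)) ^+ 2.
  have a0 : 0 < a by rewrite subr_gt0.
  have S0 : 0 <= S by apply: sumr_ge0 => y _; exact: sqr_ge0.
  (* This step length is at most 1 and satisfies [t * S <= a], so [- 2 * a + t * S] is negative. *)
  pose t := a / (a + S).
  have aS0 : 0 < a + S by lra.
  have t0 : 0 < t by rewrite divr_gt0.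
  have t1 : t <= 1 by rewrite ler_pdivrMr//; lra.
  pose ft := cast (1 - t) *: f + cast t *: g.
  have Cft : C ft.
    by apply: Cx => //; rewrite !absK_cast !ger0_norm ?subr_ge0 ?(ltW t0)//; lra.
  have reft y : dual y -> re (y ft) - re (y f) = t * (re (y g) - re (y f)).
    by move=> yd; rewrite dual_lin// reD !re_cast; ring.
  have := fmin _ Cft; rewrite (hE f ft) reft//.
  have -> : \sum_(y <- ys) (re (y ft) - re (y f)) ^+ 2 = t ^+ 2 * S.
    rewrite /S mulr_sumr big_seq [RHS]big_seq; apply: eq_bigr => y yys.
    by rewrite reft ?exprMn//; exact: ysd.
  rewrite -/a -addrA lerDl.
  have -> : - (2 * (t * a)) + t ^+ 2 * S = t * (- 2 * a + t * S) by ring.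
  rewrite pmulr_rge0//.
  have : t * S <= a by rewrite mulrAC ler_pdivrMr// mulrDr lerDr mulr_ge0// ltW.
  by move: a0; clear; lra.
have := psile (v f) (re (v f f)) (vd f) vmax.
by rewrite hpsi gerDl leNgt h_gt0.
Qed.

(** Turns a neighbourhood condition into a linear estimate; a failing [b] is refuted by taking its
    inverse for [t]. *)
Lemma scale_bound (a b d : R) : 0 <= a -> 0 < d ->
  (forall t, 0 < t -> t * a < d -> t * b < 1) -> b <= a / d.
Proof.
move=> a0 d0 h; rewrite leNgt; apply/negP => abd.
have b0 : 0 < b by apply: le_lt_trans abd; rewrite divr_ge0// ltW.
have := h b^-1; rewrite invr_gt0 mulVf ?gt_eqF// ltxx => /(_ b0).
by rewrite mulrC ltr_pdivrMr// mulrC -ltr_pdivrMr// => /(_ abd).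
Qed.

(** Equicontinuity at 0 with tolerance 1, rescaled by homogeneity. *)
Lemma equicont_bound (H : set (X -> K^o)) : equicont_dual absk p D H ->
  exists (s : seq I) (d : R), 0 < d /\ forall y f r, H y -> D f -> 0 <= r ->
    (forall i, List.In i s -> q i f <= r) -> absk (y f) <= r / d.
Proof.
move=> [Hd /(_ 0 subspace0 1 ltr01)/(sn_near_elim _ _ subspace0)[s [d [d0 h]]]].
exists s, d; split=> // y f r Hy Df r0 fr.
apply: scale_bound => // t t0 tr.
have Dtf : D (cast t *: f) by exact: subspaceZ.
have yd := Hd _ Hy.
have small i : List.In i s -> q i (cast t *: f - 0) < d.
  move=> si; rewrite subr0; apply: (le_lt_trans (snZ _ _ _ Df)); rewrite absK_cast gtr0_norm//.
  by apply: le_lt_trans tr; rewrite ler_pM2l// fr.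
have := h (cast t *: f) Dtf small y Hy.
by rewrite dual_at0// subr0 dual_scale// absKM absK_cast gtr0_norm//.
Qed.

Lemma equicont_dual1 y : dual y -> equicont_dual absk p D [set y].
Proof.
move=> yd; split=> [_ ->//|x Dx e e0].
by apply: sn_near_imp (dual_near _ _ _ yd Dx e0) => f _ h _ ->.
Qed.

(** * The epsilon product *)

Section EpsProduct.
Variables (E : lmodType K) (A : Type) (pE : A -> E -> R).
Hypothesis pE_sn : forall a, seminorm absk (pE a).
Local Notation eps := (eps_mem absk p D pE).

Lemma pE_ge0 a v : 0 <= pE a v. Proof. by have [] := pE_sn a. Qed.
Lemma pED a v w : pE a (v + w) <= pE a v + pE a w. Proof. by have [] := pE_sn a. Qed.
Lemma pEZ a k v : pE a (k *: v) = absk k * pE a v. Proof. by have [] := pE_sn a. Qed.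

Lemma pEN a v : pE a (- v) = pE a v.
Proof. by rewrite -scaleN1r pEZ absKN absK1 mul1r. Qed.

Lemma pE0 a : pE a 0 = 0.
Proof. by rewrite -(scale0r 0) pEZ absK0 mul0r. Qed.

Lemma pE_sublinear a : sublinear R isC E (pE a).
Proof. by split=> [x y|t x t0]; rewrite ?pED// pEZ absK_cast ger0_norm. Qed.

Lemma eps_lin u k y z : eps u -> dual y -> dual z -> u (k *: y + z) = k *: u y + u z.
Proof. by move=> ue yd zd; rewrite ue.1. Qed.

Lemma eps_at0 u : eps u -> u 0 = 0.
Proof.
move=> ue; have := eps_lin u (-1) 0 0 ue dual0 dual0.
by rewrite scaler0 addr0 scaleN1r addNr.
Qed.

Lemma eps_scale u k y : eps u -> dual y -> u (k *: y) = k *: u y.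
Proof. by move=> ue yd; have := eps_lin u k y 0 ue yd dual0; rewrite eps_at0// !addr0. Qed.

Lemma eps_add u y z : eps u -> dual y -> dual z -> u (y + z) = u y + u z.
Proof. by move=> ue yd zd; have := eps_lin u 1 y z ue yd zd; rewrite !scale1r. Qed.

Lemma eps_sub u v : eps u -> eps v -> eps (u - v).
Proof.
move=> ue ve; split=> [k y z yd zd|y yd a e e0].
  have -> : forall w, (u - v) w = u w - v w by [].
  by rewrite !eps_lin// scalerBr opprD addrACA.
have e2 : 0 < e / 2 by rewrite divr_gt0.
have [s [d [d0 h]]] := ue.2 y yd a _ e2.
have [s' [d' [d'0 h']]] := ve.2 y yd a _ e2.
exists (s ++ s'), (Num.min d d'); split; first by rewrite lt_min d0.
move=> z zd hz.
have : (pE a (u z - u y) < e / 2).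
  rewrite -lte_fin; apply: h => // i si.
  apply: (lt_le_trans (hz i _)); last by rewrite lee_fin ge_min lexx.
  by apply: List.in_or_app; left.
have : (pE a (v z - v y) < e / 2).
  rewrite -lte_fin; apply: h' => // i si.
  apply: (lt_le_trans (hz i _)); last by rewrite lee_fin ge_min lexx orbT.
  by apply: List.in_or_app; right.
have -> : (u - v) z - (u - v) y = (u z - u y) - (v z - v y).
  have -> : forall w, (u - v) w = u w - v w by [].
  by rewrite opprD addrACA -opprD.
rewrite lte_fin => h1 h2; apply: (le_lt_trans (pED _ _ _)); rewrite pEN; lra.
Qed.

(** Continuity at 0 involves finitely many compact sets; [acx_compact_hull] merges them into [C],
    and rescaling gives the estimate. *)
Lemma eps_bound u a : eps u -> exists C (d : R), [/\ acx_compact absk p D C, 0 < d &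
  forall y r, dual y -> (forall f, C f -> absk (y f) <= r) -> pE a (u y) <= r / d].
Proof.
move=> ue; have [s [d [d0 h]]] := ue.2 0 dual0 a 1 ltr01.
have [C [Cc [f0 Cf0] sC]] := acx_compact_hull s.
exists C, d; split=> // y r yd yr.
apply: scale_bound => //; first exact: le_trans (absK_ge0 _ _ _) (yr _ Cf0).
move=> t t0 tr; have tyd := dualZ (cast t) y yd.
have := h (cast t *: y) tyd; rewrite eps_at0// !subr0 eps_scale// pEZ absK_cast gtr0_norm//.
rewrite lte_fin; apply=> i si; apply: (@le_lt_trans _ _ (t * r)%:E); last by rewrite lte_fin.
apply: ge_ereal_sup => _ [f if_ <-]; rewrite lee_fin.
have -> : (cast t *: y) f = cast t * y f by [].
rewrite absKM absK_cast gtr0_norm// ler_pM2l//.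
by apply: yr; exact: sC if_.
Qed.

(* By Hahn-Banach and Mackey-Arens the functional norming w y is evaluation at some f in D. *)
Lemma eps_bipolar w a (G : set (X -> K^o)) y (c d : R) : eps w -> G `<=` dual -> dual y ->
  (forall f, D f -> (forall z, G z -> absk (z f) <= d) -> absk (y f) <= c) ->
  (forall z, G z -> pE a (w z) <= d) -> pE a (w y) <= c.
Proof.
move=> we Gd yd yG wG.
have [g [gD gZ gp gy]] := hahn_banach _ _ _ (pE a) (w y) (pE_sublinear a).
have [C [k [Cc k0 wC]]] := eps_bound w a we.
have CD := Cc.2.1.
(* The factor [k] absorbs the constant of [eps_bound]; it is undone in [f']. *)
have [||z r zd zr|f Cf fE] := mackey_arens C (fun z => k * g (w z)) Cc.
- by move=> z z' zd z'd; rewrite eps_add// gD mulrDr.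
- by move=> t z zd; rewrite eps_scale// gZ mulrCA.
(* By absolute convexity [C] contains the rotations of its points, so bounding real parts on [C]
   bounds absolute values. *)
- have zr' f : C f -> absk (z f) <= r.
    move=> Cf; have Df := CD _ Cf; have [b b1 <-] := re_phase _ _ (z f).
    rewrite -dual_scale//; apply: zr.
    have := Cc.1 b 0 f f Cf Cf; rewrite scale0r addr0; apply.
    by rewrite b1 absK0 addr0.
  by rewrite -ler_pdivlMl// mulrC (le_trans (gp _))// wC.
have Df := CD _ Cf.
pose f' := cast k^-1 *: f.
have Df' : D f' by exact: subspaceZ.
have gE z : dual z -> g (w z) = re (z f').
  by move=> zd; rewrite dual_scale// re_cast -fE// mulKf// gt_eqF.
(* For [z] in [G], a rotation [b] gives [absk (z f') = g (w (b *: z)) <= pE a (w z) <= d], so [yG]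
   applies to [f']. *)
rewrite -gy gE//; apply: (le_trans (re_le_abs _ _ _)); apply: yG => // z Gz.
have zd := Gd _ Gz; have [b b1 <-] := re_phase _ _ (z f').
have -> : b * z f' = (b *: z) f' by [].
rewrite -gE; last exact: dualZ.
by rewrite (le_trans (gp _))// eps_scale// pEZ b1 mul1r wG.
Qed.

End EpsProduct.
End Topology.

Arguments subspaceB {R isC X D} D_sub {f g}.
Arguments dualP {R isC X I p D y}.
Arguments sn_near_intro {R isC X I p D q} D_sub pq s {d x P}.
Arguments dualZ {R isC X I p D q} D_sub pq a {y}.
Arguments compact_sn_bounded {R isC X I p D q} D_sub pq {C} i.
Arguments equicont_bound {R isC X I p D q} D_sub pq {H}.
Arguments equicont_dual1 {R isC X I p D y}.
Arguments pE_ge0 {R isC E A pE}.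
Arguments pE0 {R isC E A pE}.
Arguments pEZ {R isC E A pE}.
Arguments eps_sub {R isC X I p D E A pE} pE_sn {u v}.
Arguments eps_scale {R isC X I p D q} D_sub pq {E A pE u} k {y}.
Arguments eps_bound {R isC X I p D q} D_sub pq {E A pE} pE_sn {u} a.
Arguments eps_bipolar {R isC X I p D q} D_sub pq {E A pE} pE_sn {w} a G {y c d}.

(** * Weighted spaces *)

Section WeightedSpace.
Variables (R : realType) (isC : bool).
Local Notation K := (Kt R isC).
Local Notation absk := (absK R isC).
Local Notation cast := (Kcast R isC).
Variables (Om J M : Type) (om : M -> Type) (nu : J -> forall m, om m -> R).
Hypothesis om_inh : forall m, inhabited (om m).
Hypothesis nu_ge0 : forall j m x, 0 <= nu j m x.
Hypothesis nu_pos : forall m (x : om m), exists j, 0 < nu j m x.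
Variables (AP : set (Om -> K^o)) (dom : M -> set (Om -> K^o)).
Variable T : forall m, (Om -> K^o) -> om m -> K^o.
Hypothesis AP_sub : lsubspace AP.
Hypothesis dom_sub : forall m, lsubspace (dom m).
Hypothesis T_lin : forall m, lin_on (dom m) (T m).
Local Notation D := (FVmem om nu (fun (_ : unit) (c : K^o) => absk c) AP dom T).
Local Notation p := (FVsn om nu (fun (_ : unit) (c : K^o) => absk c) T).
Local Notation dual := (in_dual absk p D).

Definition FVnorm (i : J * M * unit) (f : Om -> K^o) : R := fine (p i f).

(** The seminorm with index [(j, m)] is the supremum of [absk (z f)] over this set, whose absolute
    polar in [D] is therefore the unit ball of that seminorm. *)
Definition weighted_eval (j : J) (m : M) : set ((Om -> K^o) -> K^o) :=
  [set z | exists x, z = cast (nu j m x) *: (fun f => T m f x)].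

Lemma FVsnE i f : D f -> p i f = (FVnorm i f)%:E.
Proof.
move=> [_ _ /(_ i)]; rewrite /FVnorm; case: i => [[j m] a] fin.
rewrite fineK// fin_numElt fin andbT; have [x] := om_inh m.
apply: (@lt_le_trans _ _ (absk (T m f x) * nu j m x)%:E); first exact: ltNyr.
by apply: ereal_sup_ubound; exists x.
Qed.

Lemma FVnorm_ub j m a f x : D f -> absk (T m f x) * nu j m x <= FVnorm (j, m, a) f.
Proof. by move=> Df; rewrite -lee_fin -FVsnE//; apply: ereal_sup_ubound; exists x. Qed.

Lemma FVnorm_le j m a f r : D f -> (forall x, absk (T m f x) * nu j m x <= r) ->
  FVnorm (j, m, a) f <= r.
Proof.
move=> Df h; rewrite -lee_fin -FVsnE//.
by apply: ge_ereal_sup => _ [x _ <-]; rewrite lee_fin.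
Qed.

Lemma FVnorm_ge0 i f : D f -> 0 <= FVnorm i f.
Proof.
case: i => [[j m] a] Df; have [x] := om_inh m.
by rewrite (le_trans _ (FVnorm_ub _ _ _ _ x Df))// mulr_ge0 ?absK_ge0 ?nu_ge0.
Qed.

Lemma T_comb m k f g x : D f -> D g -> T m (k *: f + g) x = k * T m f x + T m g x.
Proof. by move=> [_ df _] [_ dg _]; rewrite T_lin. Qed.

Lemma T_at0 m x : T m 0 x = 0.
Proof.
have := T_lin m (-1) 0 0 (dom_sub m).1 (dom_sub m).1.
by rewrite scaler0 addr0 scaleN1r addNr => ->.
Qed.

Lemma FVmem_sub : lsubspace D.
Proof.
split=> [|k f g Df Dg].
  split; [exact: AP_sub.1 | by move=> m; exact: (dom_sub m).1 |].
  move=> [[j m] a]; apply: (@le_lt_trans _ _ 0%:E); last exact: ltry.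
  by apply: ge_ereal_sup => _ [x _ <-]; rewrite T_at0 absK0 mul0r.
have [APf df _] := Df; have [APg dg _] := Dg.
split; [exact: AP_sub.2 | by move=> m; exact: (dom_sub m).2 |].
move=> [[j m] a].
apply: (@le_lt_trans _ _ (absk k * FVnorm (j, m, a) f + FVnorm (j, m, a) g)%:E); last exact: ltry.
apply: ge_ereal_sup => _ [x _ <-]; rewrite lee_fin T_comb//.
apply: (@le_trans _ _ ((absk k * absk (T m f x) + absk (T m g x)) * nu j m x)).
  by rewrite ler_wpM2r ?nu_ge0// -absKM absKD.
by rewrite mulrDl -mulrA lerD ?ler_wpM2l ?absK_ge0 ?FVnorm_ub.
Qed.

Lemma FV_seminorms : seminorms_on absk p D FVnorm.
Proof.
split; [exact: FVsnE | exact: FVnorm_ge0 | |].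
- move=> [[j m] a] f g Df Dg; apply: FVnorm_le => [|x].
    by have := FVmem_sub.2 1 f g Df Dg; rewrite scale1r.
  rewrite -[f]scale1r T_comb// mul1r scale1r.
  apply: (@le_trans _ _ ((absk (T m f x) + absk (T m g x)) * nu j m x)).
    by rewrite ler_wpM2r ?nu_ge0// absKD.
  by rewrite mulrDl lerD ?FVnorm_ub.
- move=> [[j m] a] k f Df; have D0 := FVmem_sub.1.
  have TZ x : T m (k *: f) x = k * T m f x.
    by have := T_comb m k f 0 x Df D0; rewrite T_at0 !addr0.
  apply: FVnorm_le => [|x].
    by have := FVmem_sub.2 k f 0 Df D0; rewrite addr0.
  by rewrite TZ absKM -mulrA ler_wpM2l ?absK_ge0 ?FVnorm_ub.
Qed.

Lemma T_sub m f g x : D f -> D g -> T m f x - T m g x = T m (f - g) x.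
Proof. by move=> Df Dg; rewrite [f - g]addrC -(scaleN1r g) T_comb// mulN1r addrC. Qed.

Let D_B f g : D f -> D g -> D (f - g).
Proof. by move=> Df Dg; have := subspaceB FVmem_sub Df Dg. Qed.

(** A weight positive at [x] lets a single seminorm control the evaluation. *)
Lemma T_dual m x : dual (fun f => T m f x).
Proof.
apply: dualP => [k f g Df Dg|g e Dg e0]; first exact: T_comb.
have [j nu0] := nu_pos m x.
have d0 : 0 < e * nu j m x by rewrite mulr_gt0.
apply: (sn_near_intro FVmem_sub FV_seminorms [:: (j, m, tt)] Dg d0).
move=> f Df /(_ _ (or_introl erefl)) fg; rewrite T_sub// -(ltr_pM2r nu0).
by apply: le_lt_trans fg; apply: FVnorm_ub; exact: D_B.
Qed.

Lemma weighted_eval_dual j m : weighted_eval j m `<=` dual.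
Proof. by move=> _ [x ->]; apply: (dualZ FVmem_sub FV_seminorms); exact: T_dual. Qed.

Lemma weighted_evalE j m x f :
  absk ((cast (nu j m x) *: (fun f => T m f x)) f) = absk (T m f x) * nu j m x.
Proof.
have -> : (cast (nu j m x) *: (fun f => T m f x)) f = cast (nu j m x) * T m f x by [].
by rewrite absKM absK_cast ger0_norm ?nu_ge0// mulrC.
Qed.

Lemma weighted_eval_equicont j m : equicont_dual absk p D (weighted_eval j m).
Proof.
split=> [|g Dg e e0]; first exact: weighted_eval_dual.
apply: (sn_near_intro FVmem_sub FV_seminorms [:: (j, m, tt)] Dg e0).
move=> f Df /(_ _ (or_introl erefl)) fg _ [x ->]; apply: le_lt_trans fg.
have -> : (cast (nu j m x) *: (fun f => T m f x)) f - (cast (nu j m x) *: (fun f => T m f x)) g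
   = (cast (nu j m x) *: (fun f => T m f x)) (f - g).
  have -> : forall h, (cast (nu j m x) *: (fun f => T m f x)) h = cast (nu j m x) * T m h x by [].
  by rewrite -mulrBr T_sub.
by rewrite weighted_evalE; apply: FVnorm_ub; exact: D_B.
Qed.

Lemma FVnorm_directed (s : seq (J * M * unit)) : inhabited J -> inhabited M ->
  (forall i1 i2 : J * M * unit, exists (i3 : J * M * unit) (C : R), 0 <= C /\
     forall f, D f -> (maxe (p i1 f) (p i2 f) <= C%:E * p i3 f)%E) ->
  exists j m (C : R), 0 <= C /\
    forall i f, List.In i s -> D f -> FVnorm i f <= C * FVnorm (j, m, tt) f.
Proof.
move=> [j0] [m0] dir; elim: s => [|i s [j [m [C [C0 IH]]]]]; first by exists j0, m0, 0.
have [[[j' m'] []] [C' [C'0 h]]] := dir i (j, m, tt).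
(* [C'] handles the head of the list and [C * C'] its tail. *)
exists j', m', (C' + C * C'); split; first by rewrite addr_ge0 ?mulr_ge0.
move=> i' f si' Df; have := h f Df.
rewrite !FVsnE// -EFin_max -EFinM lee_fin ge_max => /andP[h1 h2].
have N0 := FVnorm_ge0 (j', m', tt) f Df.
case: si' => [<-|/IH/(_ Df) h3].
  by rewrite (le_trans h1)// mulrDl lerDl !mulr_ge0.
rewrite (le_trans h3)// mulrDl -mulrA.
by apply: (@le_trans _ _ (C * (C' * FVnorm (j', m', tt) f))); rewrite ?ler_wpM2l// lerDr mulr_ge0.
Qed.

(** * Elements of the epsilon-product on weighted evaluations *)

Section Operator.
Variables (E : lmodType K) (A : Type) (pE : A -> E -> R).
Hypothesis pE_sn : forall a, seminorm absk (pE a).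
Local Notation eps := (eps_mem absk p D pE).

Lemma eps_weighted_eval w a j m x : eps w ->
  pE a (w (cast (nu j m x) *: (fun f => T m f x))) =
  pE a (w (fun f => T m f x)) * nu j m x.
Proof.
move=> we; rewrite (eps_scale FVmem_sub FV_seminorms _ we (T_dual m x)).
by rewrite (pEZ pE_sn) absK_cast ger0_norm ?nu_ge0// mulrC.
Qed.

(** [eps_bound] reduces the estimate to a compact set, where the seminorm with index [(j, m)] is
    bounded. This yields finiteness of the seminorms of [Smap w]. *)
Lemma eps_T_bounded w a j m : eps w ->
  exists r : R, forall x, pE a (w (fun f => T m f x)) * nu j m x <= r.
Proof.
move=> we.
have [C [d [Cc d0 wC]]] := eps_bound FVmem_sub FV_seminorms pE_sn a we.
have [r r0 Cr] := compact_sn_bounded FVmem_sub FV_seminorms (j, m, tt) Cc.2.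
exists (r / d) => x; rewrite -eps_weighted_eval//; apply: wC => [|f Cf].
  by apply: weighted_eval_dual; exists x.
rewrite weighted_evalE; apply: le_trans (Cr _ Cf).
by apply: FVnorm_ub; exact: Cc.2.1.
Qed.

(** [j], [m] and [c] depend on [H] but not on [w], as continuity of the inverse requires.
    Directedness merges the seminorms controlling [H] into one, and [eps_bipolar] transfers the
    bound to [w]. *)
Lemma eps_inverse_bound (H : set ((Om -> K^o) -> K^o)) :
  inhabited J -> inhabited M ->
  (forall i1 i2 : J * M * unit, exists (i3 : J * M * unit) (C : R), 0 <= C /\
     forall f, D f -> (maxe (p i1 f) (p i2 f) <= C%:E * p i3 f)%E) ->
  equicont_dual absk p D H ->
  exists j m (c : R), 0 <= c /\ forall w a d, eps w -> 0 <= d ->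
    (forall x, pE a (w (fun f => T m f x)) * nu j m x <= d) ->
    forall y, H y -> pE a (w y) <= c * d.
Proof.
move=> hJ hM dir He.
have [s [b [b0 Hb]]] := equicont_bound FVmem_sub FV_seminorms He.
have [j [m [C [C0 sC]]]] := FVnorm_directed s hJ hM dir.
exists j, m, (C / b); split; first by rewrite divr_ge0// ltW.
move=> w a d we d0 wd y Hy.
apply: (eps_bipolar FVmem_sub FV_seminorms pE_sn a (weighted_eval j m) we).
- exact: weighted_eval_dual.
- exact: He.1.
- move=> f Df fG; rewrite mulrAC; apply: Hb => //; first by rewrite mulr_ge0.
  move=> i si; apply: (le_trans (sC _ _ si Df)); rewrite ler_wpM2l//.
  by apply: FVnorm_le => // x; rewrite -weighted_evalE; apply: fG; exists x.
- by move=> _ [x ->]; rewrite eps_weighted_eval.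
Qed.

End Operator.
End WeightedSpace.

Arguments eps_weighted_eval {R isC Om J M om nu} om_inh nu_ge0 nu_pos
  {AP dom T} AP_sub dom_sub T_lin {E A pE} pE_sn {w} a j {m} x.
Arguments eps_T_bounded {R isC Om J M om nu} om_inh nu_ge0 nu_pos
  {AP dom T} AP_sub dom_sub T_lin {E A pE} pE_sn {w} a j m.
Arguments eps_inverse_bound {R isC Om J M om nu} om_inh nu_ge0 nu_pos
  {AP dom T} AP_sub dom_sub T_lin {E A pE} pE_sn {H}.
Arguments weighted_eval_equicont {R isC Om J M om nu} om_inh nu_ge0 nu_pos
  {AP dom T} AP_sub dom_sub T_lin j m.

(** * The map [S] as a topological isomorphism into *)

Theorem theorem3p9
  (* scalar field K = Kt R isC : R if isC = false, C = R[i] if isC = true *)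
  (R : realType) (isC : bool)
  (* E : a non-trivial locally convex Hausdorff space over K, given by a
     directed fundamental system of seminorms (pE a)_(a : A) *)
  (E : lmodType (Kt R isC)) (A : Type) (pE : A -> E -> R)
  (hpE : forall a, seminorm (absK R isC) (pE a))
  (hdirE : directed_sn pE) (hhausE : hausdorff_sn pE)
  (hnontriv : exists e : E, e != 0)
  (* Omega, J, M, omega_m, nu *)
  (Om : Type) (hOm : inhabited Om)
  (J M : Type) (hJ : inhabited J) (hM : inhabited M)
  (om : M -> Type) (hom : forall m, inhabited (om m))
  (nu : J -> forall m, om m -> R)
  (hnu0 : forall j m x, 0 <= nu j m x)
  (hnupos : forall m (x : om m), exists j, 0 < nu j m x)
  (* AP(Omega,K), AP(Omega,E) : linear subspaces *)
  (APK : set (Om -> (Kt R isC)^o)) (APE : set (Om -> E))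
  (hAPK : lsubspace APK) (hAPE : lsubspace APE)
  (* T^K_m : dom T^K_m -> K^(omega_m), T^E_m : dom T^E_m -> E^(omega_m), linear *)
  (domK : M -> set (Om -> (Kt R isC)^o))
  (TK : forall m, (Om -> (Kt R isC)^o) -> om m -> (Kt R isC)^o)
  (domE : M -> set (Om -> E)) (TE : forall m, (Om -> E) -> om m -> E)
  (hdomK : forall m, lsubspace (domK m)) (hTK : forall m, lin_on (domK m) (TK m))
  (hdomE : forall m, lsubspace (domE m)) (hTE : forall m, lin_on (domE m) (TE m))
  (* (T^E_m, T^K_m)_m is a generator: FV(Omega) and FV(Omega,E) are dom-spaces *)
  (hdomK_sp : FV_hausdorff_directed om nu (fun (_ : unit) (c : (Kt R isC)^o) => absK R isC c)
                APK domK TK)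
  (hdelta : forall x : Om,
     in_dual (absK R isC)
       (FVsn om nu (fun (_ : unit) (c : (Kt R isC)^o) => absK R isC c) TK)
       (FVmem om nu (fun (_ : unit) (c : (Kt R isC)^o) => absK R isC c) APK domK TK)
       (fun f => f x))
  (hdomE_sp : FV_hausdorff_directed om nu pE APE domE TE)
  (* the generator is consistent *)
  (hcons : forall u : ((Om -> (Kt R isC)^o) -> (Kt R isC)^o) -> E,
     eps_mem (absK R isC)
       (FVsn om nu (fun (_ : unit) (c : (Kt R isC)^o) => absK R isC c) TK)
       (FVmem om nu (fun (_ : unit) (c : (Kt R isC)^o) => absK R isC c) APK domK TK)
       pE u ->
     APE (Smap u) /\
     forall m (x : om m), domE m (Smap u) /\ TE m (Smap u) x = u (fun f => TK m f x)) :
  let FVK := FVmem om nu (fun (_ : unit) (c : (Kt R isC)^o) => absK R isC c) APK domK TK in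
  let snK := FVsn om nu (fun (_ : unit) (c : (Kt R isC)^o) => absK R isC c) TK in
  let epsE := eps_mem (absK R isC) snK FVK pE in
  (* S is well-defined: FV(Omega) eps E -> FV(Omega,E) *)
  (forall u, epsE u -> FVmem om nu pE APE domE TE (Smap u)) /\
  (* S is injective (elements of the eps-product are maps on FV(Omega)') *)
  (forall u v, epsE u -> epsE v -> Smap u = Smap v ->
     forall y, in_dual (absK R isC) snK FVK y -> u y = v y) /\
  (* S is continuous *)
  sn_cont (eps_sn (absK R isC) snK FVK pE) epsE (FVsn om nu pE TE) Smap /\
  (* the inverse of S on its range is continuous *)
  sn_inv_cont (eps_sn (absK R isC) snK FVK pE) epsE (FVsn om nu pE TE) Smap.
Proof.
move=> FVK snK epsE.
have epsB u v (ue : epsE u) (ve : epsE v) := eps_sub hpE ue ve.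
have Sbound w a j m : epsE w -> exists r : R,
    forall x, pE a (TE m (Smap w) x) * nu j m x <= r.
  move=> we; have [r wr] := eps_T_bounded hom hnu0 hnupos
    hAPK hdomK hTK hpE a j m we.
  by exists r => x; rewrite ((hcons w we).2 m x).2.
have Hbound H (He : equicont_dual (absK R isC) snK FVK H) :
    exists j m (c : R), 0 <= c /\ forall w a d, epsE w -> 0 <= d ->
      (forall x, pE a (TE m (Smap w) x) * nu j m x <= d) ->
      forall y, H y -> pE a (w y) <= c * d.
  have [j [m [c [c0 h]]]] := eps_inverse_bound hom hnu0 hnupos
    hAPK hdomK hTK hpE hJ hM hdomK_sp.2 He.
  exists j, m, c; split=> // w a d we d0 wd y Hy; apply: h => // x.
  by rewrite -((hcons w we).2 m x).2.
split; last split; last split.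
- move=> u ue; have [Au Tu] := hcons u ue; split=> //.
    (* Consistency states membership in [domE m] only along with a point of [om m], hence the choice
       of [x]. *)
    by move=> m; have [x] := hom m; exact: (Tu m x).1.
  move=> [[j m] a]; have [r ur] := Sbound u a j m ue.
  apply: (@le_lt_trans _ _ r%:E); last exact: ltry.
  by apply: ge_ereal_sup => _ [x _ <-]; rewrite lee_fin.
- move=> u v ue ve Suv y yd.
  have we := epsB u v ue ve.
  have Sw : Smap (u - v) = 0.
    apply/funext => x; have := congr1 (fun F => F x) Suv; rewrite /Smap => /eqP.
    by rewrite -subr_eq0 => /eqP.
  (* The singleton of [y] is equicontinuous; the bound with [d = 0] makes every [pE a] vanish at
     [(u - v) y]. *)
  have [j [m [c [c0 h]]]] := Hbound _ (equicont_dual1 yd).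
  apply/eqP; rewrite -subr_eq0; apply/eqP; apply: hhausE => a.
  apply/eqP; rewrite eq_le (pE_ge0 hpE) andbT.
  have := h (u - v) a 0 we (lexx _); rewrite mulr0; apply=> // x.
  have -> : TE m (Smap (u - v)) x = 0.
    rewrite Sw; have := hTE m (-1) 0 0 (hdomE m).1 (hdomE m).1.
    by rewrite scaler0 addr0 scaleN1r addNr => ->.
  by rewrite (pE0 hpE) mul0r.
- move=> u ue [[j m] a] e e0.
  (* The epsilon-seminorm over this set dominates the target seminorm of [Smap] with constant 1. *)
  have Ge := weighted_eval_equicont hom hnu0 hnupos hAPK hdomK hTK j m.
  exists [:: (exist _ _ Ge, a)], e; split=> // v ve /(_ _ (or_introl erefl)).
  apply: le_lt_trans; have we := epsB v u ve ue.
  apply: ge_ereal_sup => _ [x _ <-]; apply: ereal_sup_ubound => /=.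
  exists (Kcast R isC (nu j m x) *: (fun f => TK m f x)); first by exists x.
  congr (_ %:E).
  rewrite (eps_weighted_eval hom hnu0 hnupos hAPK hdomK hTK hpE a j x we).
  by rewrite -((hcons _ we).2 m x).2.
- move=> u ue [[H He] a] e e0.
  have [j [m [c [c0 h]]]] := Hbound H He.
  (* Dividing by [c + 1] allows [c = 0] and keeps [c * (e / (c + 1)) < e] strict. *)
  have d0 : 0 < e / (c + 1) by rewrite divr_gt0// ltr_wpDl.
  exists [:: (j, m, a)], (e / (c + 1)); split=> // v ve /(_ _ (or_introl erefl)) Svu.
  have we := epsB v u ve ue.
  apply: (@le_lt_trans _ _ (c * (e / (c + 1)))%:E).
    apply: ge_ereal_sup => _ [y Hy <-]; rewrite lee_fin.
    apply: (h (v - u)) => //; first exact: ltW.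
    move=> x; rewrite -lee_fin; apply: le_trans (ltW Svu).
    by apply: ereal_sup_ubound; exists x.
  rewrite lte_fin mulrA ltr_pdivrMr ?ltr_wpDl//.
  by rewrite mulrC ltr_pM2l// ltrDl.
Qed.
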